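(* Let $q_\xi$ be a density from $\mathrm{EM}(\tilde c)$, where the natural statistics $\tilde c_i\in\mathcal{C}^2(\mathbb{R}^d)$ are linearly independent, and let $\phi_\xi:\mathcal{D}\to\mathbb{R}^d$ be the bijection constructed from $q_\xi$. Let $p_\theta\in\mathrm{EM}(c)$, write $x(\xi)=\phi_\xi(\tilde x)$, and set $$m(\xi)=c(x(\xi))^\top\theta-\tilde c(x(\xi))^\top\xi-(\psi(\theta)-\psi(\xi)).$$ (a) The parameter $\xi$ optimizes $E_N[1;\xi]^2$ (locally, i.e. it is a local optimum of $\xi\mapsto E_N[1;\xi]^2$) if $$\frac{\partial\psi(\xi)}{\partial\xi}-\frac{\mathbb{E}_{\theta,N}[\tilde c;\xi]}{\mathbb{E}_{\theta,N}[1;\xi]}+\frac{\mathbb{E}_{\theta,N}\left[\frac{dx}{d\xi}\frac{dm}{dx};\xi\right]}{\mathbb{E}_{\theta,N}[1;\xi]}=0 .$$ (b) In particular, if the parameter $\xi$ is chosen by the approximated moment-matching rule $$\frac{\mathbb{E}_{\theta,N}[\tilde c;\xi]}{\mathbb{E}_{\theta,N}[1;\xi]}=\frac{\partial\psi(\xi)}{\partial\xi},$$ then the selected parameter $\xi$ is a local optimum of $E_N[1;\xi]^2$ if $\mathbb{E}_{\theta,N}\left[\frac{dx}{d\xi}\frac{dm}{dx};\xi\right]=0$. (c) If $\tilde c=c$ and $\xi=\theta$, then $\xi$ is a local optimum of $E_N[1;\xi]^2$.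
   Context: $\mathcal{D}=(-1,1)^d$. For a vector $c:\mathbb{R}^d\to\mathbb{R}^m$ of linearly independent natural statistics, $\psi(\theta)=\log\int_{\mathbb{R}^d}\exp(c(x)^\top\theta)\,dx$ is the cumulant-generating function, $\Theta=\{\theta\in\mathbb{R}^m:\int_{\mathbb{R}^d}\exp(c(x)^\top\theta)\,dx<\infty\}$, and $\mathrm{EM}(c)=\{p_\theta:\ p_\theta(x)=\exp(c(x)^\top\theta-\psi(\theta)),\ \theta\in\Theta\}$; exponential families are assumed regular, i.e. $\Theta$ is open. Similarly $q_\xi(x)=\exp(\tilde c(x)^\top\xi-\psi(\xi))$ with $\tilde c:\mathbb{R}^d\to\mathbb{R}^{n_\xi}$, $\psi(\xi)=\log\int_{\mathbb{R}^d}\exp(\tilde c(x)^\top\xi)\,dx$ (same letter $\psi$; the argument tells which family is meant), and $\xi\in\Xi=\{\xi\in\mathbb{R}^{n_\xi}:\psi(\xi)<\infty\}$. The bijection $\phi_\xi$ is a smooth bijection from $\mathcal{D}$ onto $\mathbb{R}^d$ constructed from $q_\xi$ (through conditional distribution functions $2\int_{-\infty}^{z_i}q(z_1,\dots,y_i,\dots,z_d)dy_i/\int_{-\infty}^{\infty}q(z_1,\dots,y_i,\dots,z_d)dy_i-1$), so that $\left|\det\frac{\partial\phi_\xi}{\partial\tilde x}(\tilde x)\right|=\bigl(2^dq_\xi(\phi_\xi(\tilde x))\bigr)^{-1}$. The derivatives of $\phi_\xi(\tilde x)$ with respect to $\xi$ that appear are understood to exist. A $d$-dimensional quadrature rule with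 positive weight function $\omega$ on $\mathcal{D}$, nodes $\tilde x_1,\dots,\tilde x_N\in\mathcal{D}$ and weights $w_1,\dots,w_N\in\mathbb{R}$ is fixed; it approximates $\int_{\mathcal{D}}g(\tilde x)\omega(\tilde x)\,d\tilde x$ by $\sum_{i=1}^N w_i g(\tilde x_i)$. With $u(x)=p_\theta(x)/(2^dq_\xi(x))$, $$\mathbb{E}_{\theta,N}[f;\xi]=\sum_{i=1}^N w_i\,f(\phi_\xi(\tilde x_i))\,u(\phi_\xi(\tilde x_i))\,\omega(\tilde x_i)^{-1},\qquad E_N[f;\xi]=\mathbb{E}_\theta[f]-\mathbb{E}_{\theta,N}[f;\xi],$$ where $\mathbb{E}_\theta$ is the expectation with respect to $p_\theta$; in particular $E_N[1;\xi]=1-\mathbb{E}_{\theta,N}[1;\xi]$. Ratios with denominator $\mathbb{E}_{\theta,N}[1;\xi]$ presuppose that it is nonzero. $\frac{dx}{d\xi}$ is the $n_\xi\times d$ matrix of derivatives of $\xi\mapsto x(\xi)=\phi_\xi(\tilde x)$ at fixed $\tilde x$ (rows indexed by the components of $\xi$), and $\frac{dm}{dx}\in\mathbb{R}^d$ is the gradient with respect to $x$, at fixed $\xi$, of $c(x)^\top\theta-\tilde c(x)^\top\xi-(\psi(\theta)-\psi(\xi))$, evaluated at $x=x(\xi)$; in $\mathbb{E}_{\theta,N}[\cdot;\xi]$ these are evaluated at each node.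
   Formalization: ''Local optimum'' is read as a stationary point (zero differential) of E_N[1;ξ]², as the criteria also admit inflection points; (c), false as stated, assumes moment matching with E_{θ,N}[1;ξ]≠0, or a rule exact on 1/ω (then also a local minimum). *)

(* Defs.v *)
From HB Require Import structures.
From mathcomp Require Import all_boot all_order all_algebra.
From mathcomp Require Import all_classical all_reals all_analysis.

Set Implicit Arguments.
Unset Strict Implicit.
Unset Printing Implicit Defensive.

Import Order.TTheory GRing.Theory Num.Theory.
Import numFieldNormedType.Exports.

Local Open Scope classical_set_scope.
Local Open Scope ring_scope.

(* Points x and parameters theta, xi are row vectors, as required by the
   library's jacobian 'J; natural statistics c x are column vectors, so that
   c(x)^T theta is the single entry of theta *m c x. *)

Section LebesgueRd.
Variable R : realType.

Lemma measurable_consr (n : nat) :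
  measurable_fun [set: n.-tuple (measurableTypeR R) * measurableTypeR R]
    (fun p => [the n.+1.-tuple (measurableTypeR R) of p.2 :: p.1]).
Proof. exact: measurable_cons. Qed.

(* Lebesgue measure on R^n, with R^n carried by n-tuples: the library has
   their product sigma-algebra, but no n-fold product measure. *)
Fixpoint lebesgue_tuple (n : nat) :
    {measure set (n.-tuple (measurableTypeR R)) -> \bar R} :=
  match n return {measure set (n.-tuple (measurableTypeR R)) -> \bar R} with
  | 0 => [the measure _ _ of dirac [tuple]]
  | n'.+1 => measure_function_pushforward__canonical__measure_function_Measure
      [the measure _ _ of
        (lebesgue_tuple n' \x (@lebesgue_measure R))%E]
      (@measurable_consr n')
  end.

Definition rv_of_tuple (d : nat) (t : d.-tuple R) : 'rV[R]_d :=
  \row_i tnth t i.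

Definition integral_Rd (d : nat) (g : 'rV[R]_d -> R) : \bar R :=
  (\int[lebesgue_tuple d]_t (g (rv_of_tuple t))%:E)%E.

End LebesgueRd.

Section ExponentialFamily.
Variables (R : realType) (d m : nat) (c : 'rV[R]_d -> 'cV[R]_m).

(* Partition function, possibly +oo. *)
Definition Zpart (theta : 'rV[R]_m) : \bar R :=
  integral_Rd (fun x => expR ((theta *m c x) 0 0)).

Definition Theta : set 'rV[R]_m := [set theta | (Zpart theta < +oo)%E].

(* Meaningful on Theta only. *)
Definition psi (theta : 'rV[R]_m) : R := ln (fine (Zpart theta)).

Definition em_density (theta : 'rV[R]_m) (x : 'rV[R]_d) : R :=
  expR ((theta *m c x) 0 0 - psi theta).

Definition natural_statistics : Prop :=
  (forall j, measurable_fun [set: d.-tuple (measurableTypeR R)]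
               (fun t => c (rv_of_tuple t) j 0 : measurableTypeR R)) /\
  (forall a : 'rV[R]_m, (forall x, (a *m c x) 0 0 = 0) -> a = 0).

Definition regular_family : Prop := natural_statistics /\ open Theta.

End ExponentialFamily.

Section Calculus.
Variable R : realType.

Definition grad (k : nat) (f : 'rV[R]_k -> R) (x : 'rV[R]_k) : 'cV[R]_k :=
  \col_i 'D_(delta_mx 0 i) f x.

Definition C1_fun (k : nat) (f : 'rV[R]_k -> R) : Prop :=
  (forall x, differentiable f x) /\
  (forall v : 'rV[R]_k, continuous (fun x => 'D_v f x)).

Definition C2_fun (k : nat) (f : 'rV[R]_k -> R) : Prop :=
  C1_fun f /\ (forall v : 'rV[R]_k, C1_fun (fun x => 'D_v f x)).

(* Optimality in the first-order sense: F is (Frechet) differentiable at x and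
   its differential vanishes there.  An extremum proper cannot be meant in a
   criterion on first derivatives: for d = 1, c(x) = ctilde(x) = x^2,
   theta = xi = -1/2, phi_xi(s) = sigma * Phi^-1((1 + s)/2) with
   sigma^2 = -1/(2 xi), omega = 1 and the two nodes sent by phi_xi to 0 and
   sqrt 3, with w_1 = 2 w_2, E_{theta,N}[1;xi] has, as a function of sigma, an
   inflection point with horizontal tangent at sigma = 1. *)
Definition first_order_optimum (k : nat) (F : 'rV[R]_k -> R) (x : 'rV[R]_k) :
    Prop :=
  differentiable F x /\ (forall v, 'd F x v = 0).

Definition local_minimum (k : nat) (F : 'rV[R]_k -> R) (x : 'rV[R]_k) : Prop :=
  \forall y \near x, F x <= F y.

End Calculus.

Section Quadrature.
Variables (R : realType) (d : nat).

Definition cube : set 'rV[R]_d := [set x | forall i, -1 < x 0 i < 1].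

Record quadrature := Quadrature {
  qsize : nat;
  qomega : 'rV[R]_d -> R;
  qnode : 'I_qsize -> 'rV[R]_d;
  qweight : 'I_qsize -> R;
  qomega_gt0 : forall x, cube x -> 0 < qomega x;
  qnode_cube : forall i, cube (qnode i)
}.

Arguments qnode : clear implicits.
Arguments qweight : clear implicits.

(* Exactness of the rule on g = 1 / omega, for which the approximated integral
   is the volume 2^d of the cube. *)
Definition exact_on_inv_omega (Q : quadrature) : Prop :=
  \sum_(i < qsize Q) qweight Q i * (qomega Q (qnode Q i))^-1 = 2 ^+ d.

End Quadrature.

Arguments qnode {R d} q i.
Arguments qweight {R d} q i.

(* phi is a C^1 bijection from the cube onto R^d whose Jacobian determinant is
   the one obtained from the conditional distribution functions of the density
   q.  Every such phi is allowed, whatever the order in which the coordinates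
   are conditioned. *)
Definition density_bijection (R : realType) (d : nat) (q : 'rV[R]_d -> R)
    (phi : 'rV[R]_d -> 'rV[R]_d) : Prop :=
  [/\ set_bij (@cube R d) setT phi,
      (forall x, cube x -> differentiable phi x),
      (forall v x, cube x -> {for x, continuous (fun y => 'D_v phi y)}) &
      (forall x, cube x -> `| \det ('J phi x) | = (2 ^+ d * q (phi x))^-1)].

Section ProjectionQuadrature.
Variables (R : realType) (d m n : nat).
Variables (c : 'rV[R]_d -> 'cV[R]_m) (ct : 'rV[R]_d -> 'cV[R]_n).
Variables (phi : 'rV[R]_n -> 'rV[R]_d -> 'rV[R]_d) (Q : quadrature R d).
Variable theta : 'rV[R]_m.

Definition density_ratio (xi : 'rV[R]_n) (x : 'rV[R]_d) : R :=
  em_density c theta x / (2 ^+ d * em_density ct xi x).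

Definition node_expect (V : lmodType R) (xi : 'rV[R]_n) (g : 'rV[R]_d -> V) :
    V :=
  \sum_(i < qsize Q)
    (qweight Q i * density_ratio xi (phi xi (qnode Q i))
       * (qomega Q (qnode Q i))^-1) *: g (qnode Q i).

(* E_{theta,N}[f; xi] *)
Definition quad_expect (V : lmodType R) (xi : 'rV[R]_n) (f : 'rV[R]_d -> V) :
    V :=
  node_expect xi (fun s => f (phi xi s)).

Definition expect (f : 'rV[R]_d -> R) : R :=
  fine (integral_Rd (fun x => f x * em_density c theta x)).

(* E_N[f; xi] *)
Definition quad_error (xi : 'rV[R]_n) (f : 'rV[R]_d -> R) : R :=
  expect f - quad_expect xi (f : 'rV[R]_d -> R^o).

Definition quad_mass (xi : 'rV[R]_n) : R :=
  quad_expect xi (fun=> 1 : R^o).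

Definition sq_error (xi : 'rV[R]_n) : R := quad_error xi (fun=> 1) ^+ 2.

(* m as a function of x and xi; m(xi) is log_ratio xi (phi xi s). *)
Definition log_ratio (xi : 'rV[R]_n) (x : 'rV[R]_d) : R :=
  (theta *m c x) 0 0 - (xi *m ct x) 0 0 - (psi c theta - psi ct xi).

(* E_{theta,N}[(dx/dxi) (dm/dx); xi] *)
Definition chain_expect (xi : 'rV[R]_n) : 'cV[R]_n :=
  node_expect xi
    (fun s => 'J (fun z => phi z s) xi *m grad (log_ratio xi) (phi xi s)).

Definition stat_expect (xi : 'rV[R]_n) : 'cV[R]_n := quad_expect xi ct.

Definition moment_matching (xi : 'rV[R]_n) : Prop :=
  (quad_mass xi)^-1 *: stat_expect xi = grad (psi ct) xi.

End ProjectionQuadrature.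

(* Main.v *)
Require Import Defs.
From HB Require Import structures.
From mathcomp Require Import all_boot all_order all_algebra.
From mathcomp Require Import all_classical all_reals all_analysis.
From mathcomp Require Import measurable_realfun ring lra.

Set Implicit Arguments.
Unset Strict Implicit.
Unset Printing Implicit Defensive.

Import Order.TTheory GRing.Theory Num.Theory.
Import numFieldNormedType.Exports.

Local Open Scope classical_set_scope.
Local Open Scope ring_scope.

(** The error E_N[1; xi] is a constant minus the quadrature mass
    M(xi) = sum_i k_i exp(m_i(xi)), where k_i = w_i / (2^d omega(x_i)) and m_i
    is the log density ratio m along the i-th node phi_xi(x_i): indeed
    u = exp(m) / 2^d.  By the chain rule
      dm_i/dxi = (dx/dxi)(dm/dx) + dpsi/dxi - ctilde(x_i(xi)),
    so that, summing over the nodes,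
      dM/dxi = E[(dx/dxi)(dm/dx)] + M dpsi/dxi - E[ctilde].
    This is M times the left-hand side of the criterion; when the criterion
    holds dM vanishes, and so does the differential -2 (1 - M) dM of the
    squared error ([is_diff_quad_mass], [is_diff_sq_error]).

    The analytic point is that psi has a Frechet derivative on the open set
    Theta.  In [differentiable_laplace] this is proved for the Laplace transform
    of any measure, at any point near which it is finite.  If S is the sum of
    the |c_j|, then |<h, c>| <= |h| S, so the first-order Taylor remainder of
    exp(<h, c>) is at most |h|^2 S^2 exp(|h| S).  Finiteness of the transform
    at x + rho e_j and x - rho e_j for all j makes exp(r S) exp(<x, c>)
    integrable for a small r ([integrable_envelope]), and this dominates the
    factor S^2 exp(|h| S) when |h| <= r / 3.  The remainder of the transform is
    thus O(|h|^2).

    When ctilde = c and xi = theta, m is identically zero at xi: its gradient in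
    x vanishes, and moment matching gives the criterion.  Moreover M(xi) is then
    the quadrature approximation of the volume of the cube divided by that
    volume, so that a rule exact on 1 / omega has squared error 0, which is a
    minimum and a critical point. *)

(** * Elementary inequalities *)

Lemma dot_le (R : realType) n (h : 'rV[R]_n) (v : 'cV[R]_n) :
  `|(h *m v) 0 0| <= `|h| * \sum_j `|v j 0|.
Proof.
rewrite mxE mulr_sumr; apply: (le_trans (ler_norm_sum _ _ _)).
apply: ler_sum => j _; rewrite normrM ler_wpM2r//.
rewrite [leRHS]/Num.norm/= mx_normrE.
exact: (@le_bigmax_cond _ _ _ _ (0, j) xpredT (fun i => `|h i.1 i.2|)).
Qed.

(** Both 1 + a <= exp a and 1 - a <= exp (- a) enter: the second, multiplied by
    exp a, bounds the increment exp a - 1 by a exp a. *)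
Lemma expR_taylor1 (R : realType) (a : R) :
  `|expR a - (1 + a)| <= a ^+ 2 * expR `|a|.
Proof.
have h1 := expR_ge1Dx a; have h2 := expR_ge1Dx (- a).
have ea := expR_gt0 a.
rewrite expRN in h2.
have h3 : expR a - 1 <= a * expR a.
  have : (1 - a) * expR a <= 1 by rewrite -ler_pdivlMr// div1r.
  lra.
rewrite ger0_norm ?subr_ge0//.
have [a0|a0] := leP 0 a.
  rewrite ger0_norm//.
  have : a * (expR a - 1) <= a * (a * expR a) by apply: ler_wpM2l.
  rewrite expr2 -mulrA; lra.
have e1 : 1 <= expR `|a| by rewrite -[leLHS]expR0 ler_expR.
have : a ^+ 2 * 1 <= a ^+ 2 * expR `|a|.
  by apply: ler_wpM2l => //; exact: sqr_ge0.
have : a * (expR a - 1) <= a * a.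
  by rewrite ler_wnM2l ?(ltW a0)//; lra.
rewrite mulr1 expr2; lra.
Qed.

(** The sum is at most n times its largest term, whose exponential is one of the
    summands on the right; the 1 covers n = 0. *)
Lemma expR_sum_le (R : realType) n (y : 'I_n -> R) :
  expR (\sum_j y j) <= 1 + \sum_j expR (n%:R * y j).
Proof.
case: n y => [|n] y; first by rewrite !big_ord0 expR0 addr0.
have [k _ kP] :=
  @Order.TotalTheory.arg_maxP _ _ _ (ord0 : 'I_n.+1) xpredT y isT.
rewrite [in leRHS](bigD1 k)//=.
have s0 : 0 <= \sum_(i < n.+1 | i != k) expR (n.+1%:R * y i).
  by apply: sumr_ge0 => i _; exact: expR_ge0.
apply: (@le_trans _ _ (expR (n.+1%:R * y k))); last first.
  by rewrite addrCA lerDl addr_ge0.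
rewrite ler_expR mulr_natl -[X in _ *+ X]card_ord -sumr_const.
by apply: ler_sum => i _; exact: kP.
Qed.

(** * Calculus on row vectors *)

(** The linear form h |-> <h, G>, named so that it can carry its linear
    structure. *)
Definition dot (R : realType) n (G : 'cV[R]_n) (h : 'rV[R]_n) : R :=
  (h *m G) 0 0.

Fact dot_linear (R : realType) n (G : 'cV[R]_n) : linear (dot G).
Proof. by move=> a u v; rewrite /dot mulmxDl -scalemxAl !mxE. Qed.

HB.instance Definition _ (R : realType) n (G : 'cV[R]_n) :=
  GRing.isLinear.Build R 'rV[R]_n R _ (dot G) (dot_linear G).

Lemma continuous_dot (R : realType) n (G : 'cV[R]_n) : continuous (dot G).
Proof.
apply: bounded_linear_continuous; apply/linear_boundedP; near=> k => h.
by apply: (le_trans (dot_le _ _)); rewrite mulrC ler_wpM2r.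
Unshelve. all: by end_near. Qed.

Lemma is_diff_dot (R : realType) n (G : 'cV[R]_n) (x : 'rV[R]_n) :
  is_diff x (fun h => (h *m G) 0 0) (fun h => (h *m G) 0 0).
Proof.
have dotE : (fun h : 'rV[R]_n => (h *m G) 0 0) = dot G by [].
rewrite dotE; apply: DiffDef.
  exact: (linear_differentiable x (@continuous_dot _ _ G)).
exact: (diff_lin x (@continuous_dot _ _ G)).
Qed.

Lemma is_diff_coord (R : realType) n (j : 'I_n) (x : 'rV[R]_n) :
  is_diff x (fun z => z 0 j) (fun v => v 0 j).
Proof.
rewrite (_ : (fun z : 'rV[R]_n => z 0 j) =
    fun h => (h *m (delta_mx j 0 : 'cV[R]_n)) 0 0); first exact: is_diff_dot.
apply/funext => h; rewrite mxE (bigD1 j)//= big1 => [|i /negPf ij].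
  by rewrite mxE !eqxx mulr1 addr0.
by rewrite mxE ij mulr0.
Qed.

Lemma diff_grad (R : realType) k (f : 'rV[R]_k -> R) (x v : 'rV[R]_k) :
  differentiable f x -> 'd f x v = (v *m grad f x) 0 0.
Proof.
move=> df; rewrite {1}[v]row_sum_delta linear_sum/= mxE.
by apply: eq_bigr => i _; rewrite linearZ/= mxE deriveE.
Qed.

Lemma differentiable_quadratic_remainder (R : realType)
    (V W : normedModType R) (f : V -> W) (df : {linear V -> W}) (x : V)
    (K : R) :
  continuous df ->
  (\forall h \near (0 : V), `|f (h + x) - (f x + df h)| <= K * `|h| ^+ 2) ->
  differentiable f x.
Proof.
move=> dfc rem.
have fE : f \o shift x = cst (f x) + df +o_ 0 id.
  apply/eqaddoP => _ /posnumP[e]; near=> h.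
  have /le_trans : `|f (h + x) - (f x + df h)| <= K * `|h| ^+ 2 by near: h.
  apply; rewrite expr2 mulrA ler_wpM2r//.
  apply: (@le_trans _ _ ((`|K| + 1) * `|h|)).
    by rewrite ler_wpM2r// (le_trans (ler_norm _))// lerDl.
  have K1 : 0 < `|K| + 1 by rewrite ltr_wpDl.
  by rewrite -ler_pdivlMl//.
by apply/diff_locallyP; rewrite (diff_unique dfc fE).
Unshelve. all: by end_near. Qed.

Lemma is_diff_sum (R : realType) (V : normedModType R) n
    (f df : 'I_n -> V -> R) (x : V) :
  (forall i, is_diff x (f i) (df i)) ->
  is_diff x (fun z => \sum_i f i z) (fun v => \sum_i df i v).
Proof.
move=> fdf.
rewrite (_ : (fun z => \sum_i f i z) = \sum_i f i); last first.
  by apply/funext => z; rewrite fct_sumE.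
rewrite (_ : (fun z => \sum_i df i z) = \sum_i df i); last first.
  by apply/funext => z; rewrite fct_sumE.
elim/big_ind2 : _ => //; first exact: is_diff_cst.
by move=> f1 df1 f2 df2 ? ?; exact: is_diffD.
Qed.

Lemma is_diff_expR_comp (R : realType) (V : normedModType R)
    (f df : V -> R) (x : V) :
  is_diff x f df ->
  is_diff x (fun z => expR (f z)) (fun v => expR (f x) * df v).
Proof.
move=> fdf.
have dexp : is_diff (f x) (@expR R) (fun h => expR (f x) * h).
  have de : differentiable (@expR R) (f x).
    exact/derivable1_diffP/derivable_expR.
  apply: DiffDef => //; rewrite diff1E//; apply/funext => h.
  by rewrite derive1E (congr1 (@^~ (f x)) (@derive_expR R)) mulrC.
exact: (is_diff_comp fdf dexp).
Qed.

Lemma differentiable_dotr (R : realType) (V : normedModType R) n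
    (a : 'rV[R]_n) (C : V -> 'cV[R]_n) (x : V) :
  (forall j, differentiable (fun y => C y j 0) x) ->
  differentiable (fun y => (a *m C y) 0 0) x.
Proof.
move=> dC; under eq_fun do rewrite mxE.
have dZ j := is_diffZ (a 0 j) (differentiableP (dC j)).
by have [dS _] := is_diff_sum dZ.
Qed.

(** In the product rule the derivative of C is multiplied by z - x, which is zero
    at x; only the derivative of z - x itself survives. *)
Lemma is_diff_dot_vanishing (R : realType) n
    (C : 'rV[R]_n -> 'cV[R]_n) (x : 'rV[R]_n) :
  (forall j, differentiable (fun y => C y j 0) x) ->
  is_diff x (fun z => ((z - x) *m C z) 0 0) (fun v => (v *m C x) 0 0).
Proof.
move=> dC.
rewrite (_ : (fun z => _) = fun z => \sum_j (z - x) 0 j * C z j 0); last first.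
  by apply/funext => z; rewrite mxE.
suff : is_diff x (fun z => \sum_j (z - x) 0 j * C z j 0)
    (fun v : 'rV[R]_n => \sum_j v 0 j * C x j 0).
  by move=> /is_diff_eq; apply; apply/funext => v; rewrite mxE.
apply: is_diff_sum => j.
have dc : is_diff x (fun z : 'rV[R]_n => (z - x) 0 j) (fun v => v 0 j).
  rewrite (_ : (fun z => _) =
      (fun z : 'rV[R]_n => z 0 j) - cst (x 0 j)); last first.
    by apply/funext => z; rewrite !mxE.
  have dB := is_diffB (is_diff_coord j x) (is_diff_cst (x 0 j) x).
  by apply: is_diff_eq dB _; rewrite subr0.
apply: is_diff_eq (is_diffM dc (differentiableP (dC j))) _.
by apply/funext => v; rewrite subrr mxE scale0r add0r !fctE mulrC.
Qed.

(** * Differentiability of Laplace transforms *)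

Lemma Rintegral_sum (R : realType) d (T : measurableType d)
    (mu : {measure set T -> \bar R}) n (f : 'I_n -> T -> R) :
  (forall i, mu.-integrable setT (EFin \o f i)) ->
  \int[mu]_t (\sum_i f i t) = \sum_i \int[mu]_t f i t.
Proof.
move=> fi; rewrite /Rintegral.
under eq_integral do rewrite -sumEFin.
rewrite integral_sum//= -sum_fine// => i _.
by apply: integrable_fin_num => //; exact: fi.
Qed.

Lemma measurable_dot (R : realType) d (T : measurableType d) n
    (C : T -> 'cV[R]_n) (z : 'rV[R]_n) :
  (forall j, measurable_fun setT (fun t => C t j 0)) ->
  measurable_fun setT (fun t => (z *m C t) 0 0).
Proof.
move=> mC; under eq_fun do rewrite mxE.
by apply: measurable_sum => j; exact: measurable_funM.
Qed.

Lemma measurable_expR_dot (R : realType) d (T : measurableType d) n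
    (C : T -> 'cV[R]_n) (z : 'rV[R]_n) :
  (forall j, measurable_fun setT (fun t => C t j 0)) ->
  measurable_fun setT (fun t => expR ((z *m C t) 0 0)).
Proof.
by move=> mC; apply: measurableT_comp => //; exact: measurable_dot.
Qed.

Lemma integrable_expR_dot (R : realType) d (T : measurableType d)
    (mu : {measure set T -> \bar R}) n (C : T -> 'cV[R]_n) (z : 'rV[R]_n) :
  (forall j, measurable_fun setT (fun t => C t j 0)) ->
  (\int[mu]_t (expR ((z *m C t) 0 0))%:E < +oo)%E ->
  mu.-integrable setT (fun t => (expR ((z *m C t) 0 0))%:E).
Proof.
move=> mC fin; apply/integrableP; split.
  by apply/measurable_EFinP; exact: measurable_expR_dot.
by under eq_integral do rewrite gee0_abs ?lee_fin ?expR_ge0//.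
Qed.

(** Domination for differentiating under the integral: exp(r S), with S the sum
    of the |C_j|, is bounded by a sum of exponentials exp(rho C_j) and
    exp(- rho C_j), each of which multiplied by exp(<x, C>) is the integrand of
    the transform at a point of the ball where it is finite. *)
Lemma integrable_envelope (R : realType) d (T : measurableType d)
    (mu : {measure set T -> \bar R}) n (C : T -> 'cV[R]_n) (x : 'rV[R]_n) :
  (forall j, measurable_fun setT (fun t => C t j 0)) ->
  (\forall z \near x, (\int[mu]_t (expR ((z *m C t) 0 0))%:E < +oo)%E) ->
  exists2 r : R, 0 < r & mu.-integrable setT
    (fun t => (expR (r * \sum_j `|C t j 0|) * expR ((x *m C t) 0 0))%:E).
Proof.
move=> mC finx.
have mS : measurable_fun setT (fun t => \sum_j `|C t j 0|).
  by apply: measurable_sum => j; exact: measurableT_comp.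
have /nbhs_ballP[e /= e0 xe] := finx.
have int0 : mu.-integrable setT (fun t => (expR ((x *m C t) 0 0))%:E).
  by apply: integrable_expR_dot => //; exact: nbhs_singleton finx.
(* A factor n.+1 > n leaves n * r <= rho < e, also when n = 0. *)
pose rho := e / 2; pose r := rho / n.+1%:R.
have rho0 : 0 < rho by rewrite divr_gt0.
have r0 : 0 < r by rewrite divr_gt0.
have nr : n%:R * r <= rho.
  rewrite /r mulrA ler_pdivrMr// [leRHS]mulrC ler_pM2r// ler_nat.
  exact: leqnSn.
have intj j (s : R) : `|s| = rho ->
    mu.-integrable setT
      (fun t => (expR (((x + s *: delta_mx 0 j) *m C t) 0 0))%:E).
  move=> se; apply: integrable_expR_dot => //; apply: xe.
  rewrite -ball_normE/= opprD addrA subrr add0r normrN normrZ se.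
  apply: (@le_lt_trans _ _ rho); last by rewrite /rho; lra.
  rewrite ler_piMr// ?(ltW rho0)//.
  rewrite [leLHS]/Num.norm/= mx_normrE; apply: bigmax_le => // i _.
  by rewrite mxE; case: andP; rewrite ?normr1 ?normr0.
exists r => //.
pose B t := (expR ((x *m C t) 0 0)
  + \sum_j (expR (((x + rho *: delta_mx 0 j) *m C t) 0 0)
          + expR (((x + (- rho) *: delta_mx 0 j) *m C t) 0 0)))%R.
apply: (@le_integrable _ _ _ _ _ measurableT _ (EFin \o B)).
- apply/measurable_EFinP; apply: measurable_funM.
    by apply: measurableT_comp => //; exact: measurable_funM.
  exact: measurable_expR_dot.
- move=> t _ /=; rewrite lee_fin ger0_norm ?mulr_ge0 ?expR_ge0//.
  apply: le_trans (ler_norm _).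
  rewrite mulr_sumr.
  apply: (@le_trans _ _ ((1 + \sum_j expR (n%:R * (r * `|C t j 0|)))
                          * expR ((x *m C t) 0 0))).
    by rewrite ler_wpM2r ?expR_ge0// expR_sum_le.
  rewrite mulrDl mul1r lerD2l mulr_suml; apply: ler_sum => j _.
  have dotE s : ((x + s *: delta_mx 0 j) *m C t) 0 0
      = (x *m C t) 0 0 + s * C t j 0.
    by rewrite mulmxDl -scalemxAl -rowE !mxE.
  rewrite !dotE -expRD addrC mulrA.
  have h : n%:R * r * `|C t j 0| <= rho * `|C t j 0| by rewrite ler_wpM2r.
  have [c0|c0] := leP 0 (C t j 0).
    rewrite ger0_norm// in h *.
    by apply: ler_wpDr; rewrite ?expR_ge0// ler_expR lerD2l.
  rewrite ltr0_norm// in h *.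
  by apply: ler_wpDl; rewrite ?expR_ge0// ler_expR lerD2l mulNr -mulrN.
- rewrite (_ : EFin \o B = fun t => ((expR ((x *m C t) 0 0))%:E + \sum_j
      ((expR (((x + rho *: delta_mx 0 j) *m C t) 0 0))%:E
     + (expR (((x + (- rho) *: delta_mx 0 j) *m C t) 0 0))%:E))%E); last first.
    by apply/funext => t /=; rewrite EFinD -sumEFin.
  apply: integrableD => //; apply: integrable_sum => // j _.
  by apply: integrableD => //; apply: intj; rewrite ?normrN gtr0_norm.
Qed.

(** The vector G is the integral of C exp(<x, C>), the expected gradient, and K
    comes from the envelope: with delta = r / 3 and |h| <= delta, the Taylor
    remainder of exp(<h, C>) is at most
    |h|^2 S^2 exp(delta S) <= |h|^2 delta^-2 exp(3 delta S). *)
Lemma laplace_remainder (R : realType) d (T : measurableType d)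
    (mu : {measure set T -> \bar R}) n (C : T -> 'cV[R]_n) (x : 'rV[R]_n) :
  (forall j, measurable_fun setT (fun t => C t j 0)) ->
  (\forall z \near x, (\int[mu]_t (expR ((z *m C t) 0 0))%:E < +oo)%E) ->
  exists (G : 'cV[R]_n) (K : R), \forall h \near (0 : 'rV[R]_n),
    `|\int[mu]_t (expR (((h + x) *m C t) 0 0)) -
      (\int[mu]_t (expR ((x *m C t) 0 0)) + (h *m G) 0 0)| <= K * `|h| ^+ 2.
Proof.
move=> mC /(integrable_envelope mC)[r r0 intW].
pose S t := \sum_j `|C t j 0|.
pose g t := expR ((x *m C t) 0 0).
pose W t := expR (r * S t) * g t.
have S0 t : 0 <= S t by apply: sumr_ge0.
have g0 t : 0 <= g t by exact: expR_ge0.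
have mg : measurable_fun setT g by exact: measurable_expR_dot.
(* One third of r for each of the two factors S and one for exp(|h| S). *)
pose dlt := r / 3; have d0 : 0 < dlt by rewrite divr_gt0.
have dom (f : T -> R) k : measurable_fun setT f -> 0 <= k ->
    (forall t, `|f t| <= k * W t) -> mu.-integrable setT (EFin \o f).
  move=> mf k0 fW; apply: (@le_integrable _ _ _ _ _ measurableT _
    (fun t => k%:E * (W t)%:E)%E); first exact/measurable_EFinP.
  - by move=> t _ /=; rewrite lee_fin; apply: le_trans (ler_norm _).
  - exact: integrableZl.
(* y <= exp y at y = delta S absorbs a factor S into the envelope. *)
have SW t : S t <= dlt^-1 * expR (r * S t).
  rewrite -(ler_pM2l d0) mulrA divff ?gt_eqF// mul1r.
  apply: (@le_trans _ _ (expR (dlt * S t))).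
    have := expR_ge1Dx (dlt * S t); lra.
  rewrite ler_expR ler_wpM2r// /dlt; lra.
have iCg j : mu.-integrable setT (EFin \o (fun t => C t j 0 * g t)).
  apply: (@dom _ dlt^-1); first exact: measurable_funM.
    by rewrite invr_ge0 ltW.
  move=> t; rewrite normrM (ger0_norm (g0 t)) /W mulrA ler_wpM2r//.
  by apply: le_trans (SW t); rewrite /S (bigD1 j)//= lerDl; apply: sumr_ge0.
have ig : mu.-integrable setT (EFin \o g).
  apply: (@dom _ 1) => // t; rewrite ger0_norm// mul1r /W ler_peMl//.
  by rewrite -[leLHS]expR0 ler_expR mulr_ge0// ltW.
pose G : 'cV[R]_n := \col_j \int[mu]_t (C t j 0 * g t).
exists G, (dlt^-1 ^+ 2 * \int[mu]_t W t).
near=> h.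
have hd : `|h| <= dlt.
  by near: h; apply: (@nbhs0_le _ 'rV[R]_n).
have ah t : `|(h *m C t) 0 0| <= dlt * S t.
  by apply: (le_trans (dot_le _ _)); rewrite ler_wpM2r// S0.
have ihg : mu.-integrable setT (EFin \o (fun t => (h *m C t) 0 0 * g t)).
  apply: (@dom _ 1) => //.
    by apply: measurable_funM => //; exact: measurable_dot.
  move=> t; rewrite normrM (ger0_norm (g0 t)) mul1r ler_wpM2r//.
  apply: (le_trans (ah t)); apply: (@le_trans _ _ (r * S t)).
    by rewrite ler_wpM2r// /dlt; lra.
  have := expR_ge1Dx (r * S t); lra.
have GE : (h *m G) 0 0 = \int[mu]_t ((h *m C t) 0 0 * g t).
  rewrite mxE.
  under eq_bigr => j _.
    rewrite mxE -RintegralZl//=; over.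
  rewrite -Rintegral_sum; last first.
    move=> j; rewrite (_ : _ \o _ =
      fun t => ((h 0 j)%:E * (C t j 0 * g t)%:E)%E)//.
    apply: integrableZl => //; exact: iCg.
  apply: eq_Rintegral => t _; rewrite mxE mulr_suml.
  by apply: eq_bigr => j _; rewrite mulrA.
have expE t : expR (((h + x) *m C t) 0 0) = expR ((h *m C t) 0 0) * g t.
  by rewrite mulmxDl mxE expRD.
have ihx : mu.-integrable setT (EFin \o (fun t => expR (((h + x) *m C t) 0 0))).
  apply: (@dom _ 1) => //; first exact: measurable_expR_dot.
  move=> t; rewrite expE mul1r ger0_norm ?mulr_ge0 ?expR_ge0// ler_wpM2r//.
  rewrite ler_expR; apply: (le_trans (ler_norm _)); apply: (le_trans (ah t)).
  by rewrite ler_wpM2r// /dlt; lra.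
have isum : mu.-integrable setT
    (EFin \o (fun t => g t + (h *m C t) 0 0 * g t)).
  exact: (integrableD measurableT ig ihg).
rewrite GE -RintegralD// -RintegralB//.
have irem : mu.-integrable setT (EFin \o (fun t =>
    expR (((h + x) *m C t) 0 0) - (g t + (h *m C t) 0 0 * g t))).
  exact: (integrableB measurableT ihx isum).
apply: (le_trans (le_normr_Rintegral _ irem)) => //.
rewrite mulrAC -RintegralZl//.
apply: le_Rintegral => //.
- exact: (@integrable_norm _ _ _ _ _ _ irem).
- rewrite (_ : _ \o _ = fun t => ((dlt^-1 ^+ 2 * `|h| ^+ 2)%:E * (W t)%:E)%E)//.
  exact: integrableZl.
move=> t _ /=; rewrite expE.
have -> : expR ((h *m C t) 0 0) * g t - (g t + (h *m C t) 0 0 * g t)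
  = (expR ((h *m C t) 0 0) - (1 + (h *m C t) 0 0)) * g t by ring.
rewrite normrM (ger0_norm (g0 t)) /W mulrA ler_wpM2r//.
apply: (le_trans (expR_taylor1 _)).
have hS : `|(h *m C t) 0 0| <= `|h| * S t by exact: dot_le.
have eS : dlt * S t <= expR (dlt * S t).
  have := expR_ge1Dx (dlt * S t); lra.
apply: (@le_trans _ _ ((`|h| * S t) ^+ 2 * expR (dlt * S t))).
  apply: ler_pM; rewrite ?sqr_ge0 ?expR_ge0 ?ler_expR//.
  by rewrite -real_normK ?num_real// lerXn2r// nnegrE mulr_ge0.
rewrite [leRHS](_ : _ = `|h| ^+ 2 * (dlt^-1 ^+ 2 * expR (r * S t))).
  2: by ring.
rewrite exprMn -mulrA ler_wpM2l ?sqr_ge0//.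
have -> : r * S t = dlt * S t + (dlt * S t + dlt * S t) by rewrite /dlt; field.
rewrite !expRD [expR _ * (_ * _)]mulrC mulrA ler_wpM2r ?expR_ge0//.
rewrite -expr2 -exprMn lerXn2r// ?nnegrE ?mulr_ge0 ?expR_ge0 ?invr_ge0//.
  by rewrite ltW.
by rewrite ler_pdivlMl.
Unshelve. all: by end_near. Qed.

Lemma differentiable_laplace (R : realType) d (T : measurableType d)
    (mu : {measure set T -> \bar R}) n (C : T -> 'cV[R]_n) (x : 'rV[R]_n) :
  (forall j, measurable_fun setT (fun t => C t j 0)) ->
  (\forall z \near x, (\int[mu]_t (expR ((z *m C t) 0 0))%:E < +oo)%E) ->
  differentiable (fun z => \int[mu]_t (expR ((z *m C t) 0 0))) x.
Proof.
move=> mC /(laplace_remainder mC)[G [K rem]].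
exact: differentiable_quadratic_remainder (@continuous_dot _ _ G) rem.
Qed.

(** * Partition functions over Lebesgue measure *)

Lemma lebesgue_tuple_setT_gt0 (R : realType) d :
  (0 < lebesgue_tuple R d setT)%E.
Proof.
elim: d => [|d IH] /=.
  by rewrite diracE in_setT lte_fin.
rewrite /pushforward preimage_setT -setXTT product_measure1E//=.
rewrite mule_gt0// -set_itvNyy [ltRHS]lebesgue_measure_itv.
by rewrite /= lt0y.
Qed.

(** A positive function has zero integral only for the zero measure.  Positivity
    makes the logarithm in psi differentiable and the density normalizable. *)
Lemma Zpart_gt0 (R : realType) d m (c : 'rV[R]_d -> 'cV[R]_m) (z : 'rV[R]_m) :
  natural_statistics c -> (0 < Zpart c z)%E.
Proof.
move=> [mc _]; rewrite lt_neqAle integral_ge0 ?andbT; last first.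
  by move=> t _; rewrite lee_fin expR_ge0.
apply/eqP => /esym Z0.
have mf : measurable_fun setT (fun t : d.-tuple (measurableTypeR R) =>
    (expR ((z *m c (rv_of_tuple t)) 0 0))%:E).
  apply/measurable_EFinP.
  exact: (@measurable_expR_dot _ _ _ _ (fun t => c (rv_of_tuple t))).
have /(ae_eq_integral_abs _ measurableT mf) : (\int[lebesgue_tuple R d]_t
    `| (expR ((z *m c (rv_of_tuple t)) 0 0))%:E | = 0)%E.
  rewrite -[RHS]Z0; apply: eq_integral => t _.
  by rewrite gee0_abs// lee_fin expR_ge0.
move=> [N [mN N0 subN]].
have := lebesgue_tuple_setT_gt0 R d; rewrite -N0.
suff -> : N = setT by rewrite ltxx.
rewrite -subTset; apply: subset_trans subN => t _ /= /(_ I) [] /eqP.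
by rewrite expR_eq0.
Qed.

Lemma Theta_near (R : realType) d m (c : 'rV[R]_d -> 'cV[R]_m) (z : 'rV[R]_m) :
  regular_family c -> Theta c z -> \forall y \near z, (Zpart c y < +oo)%E.
Proof. by move=> [_ oc] cz; apply: open_nbhs_nbhs. Qed.

Lemma differentiable_psi (R : realType) d m (c : 'rV[R]_d -> 'cV[R]_m)
    (z : 'rV[R]_m) :
  regular_family c -> Theta c z -> differentiable (psi c) z.
Proof.
move=> rc cz.
apply: (@differentiable_comp _ _ _ _ (fun y => fine (Zpart c y)) (@ln R)).
  apply: (@differentiable_laplace _ _ _ (lebesgue_tuple R d) _
    (fun t => c (rv_of_tuple t))).
    by case: rc => [[]].
  exact: Theta_near.
apply/derivable1_diffP; apply: ex_derive; apply: is_derive1_ln.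
by rewrite fine_gt0// Zpart_gt0//=; case: rc.
Qed.

Lemma expect_one (R : realType) d m (c : 'rV[R]_d -> 'cV[R]_m) (z : 'rV[R]_m) :
  natural_statistics c -> Theta c z -> expect c z (fun=> 1) = 1.
Proof.
move=> nc cz; have Z0 := Zpart_gt0 z nc.
have fZ : 0 < fine (Zpart c z) by rewrite fine_gt0// Z0.
rewrite /expect /integral_Rd.
under eq_integral do rewrite mul1r /em_density expRB lnK ?posrE// mulrC EFinM.
rewrite ge0_integralZl//.
- rewrite -[X in (_ * X)%E]/(Zpart c z) -[X in (_ * X)%E]fineK; last first.
    by rewrite ge0_fin_numE// ltW.
  by rewrite -EFinM/= mulVf// gt_eqF.
- apply/measurable_EFinP; case: nc => mc _.
  exact: (@measurable_expR_dot _ _ _ _ (fun t => c (rv_of_tuple t))).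
- by rewrite lee_fin invr_ge0 ltW.
Qed.

(** * Differential of the quadrature error *)

Lemma density_ratioE (R : realType) d m n (c : 'rV[R]_d -> 'cV[R]_m)
    (ct : 'rV[R]_d -> 'cV[R]_n) (theta : 'rV[R]_m) (z : 'rV[R]_n)
    (x : 'rV[R]_d) :
  density_ratio c ct theta z x = (2 ^+ d)^-1 * expR (log_ratio c ct theta z x).
Proof.
have shuffle (a b p q : R) : a - p + - (b - q) = a - b - (p - q) by ring.
rewrite /density_ratio /em_density /log_ratio invfM mulrCA -expRN -expRD.
by rewrite shuffle.
Qed.

(** The chain rule for m(z) = m(z, x(z)).  Freezing the parameter at xi splits
    it into m(xi, x(z)), which carries the term (dx/dxi)(dm/dx), the increment
    of psi, and the pairing of z - xi with ct (x z), which vanishes at xi. *)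
Lemma is_diff_log_ratio (R : realType) d m n (c : 'rV[R]_d -> 'cV[R]_m)
    (ct : 'rV[R]_d -> 'cV[R]_n) (theta : 'rV[R]_m)
    (x : 'rV[R]_n -> 'rV[R]_d) (xi : 'rV[R]_n) :
  (forall j, differentiable (fun y => c y j 0) (x xi)) ->
  (forall j, differentiable (fun y => ct y j 0) (x xi)) ->
  differentiable x xi -> differentiable (psi ct) xi ->
  is_diff xi (fun z => log_ratio c ct theta z (x z))
    (fun v => (v *m ('J x xi *m grad (log_ratio c ct theta xi) (x xi)
                     + (grad (psi ct) xi - ct (x xi)))) 0 0).
Proof.
move=> dc dct dx dpsi.
have shuffle (a b b' p q q' : R) :
  a - b - (p - q) = a - b' - (p - q') + (q - q' - (b - b')) by ring.
rewrite (_ : (fun z => log_ratio c ct theta z (x z)) =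
  (log_ratio c ct theta xi \o x) +
  ((psi ct - cst (psi ct xi)) -
   (fun z => ((z - xi) *m ct (x z)) 0 0))); last first.
  apply/funext => z; rewrite !fctE /log_ratio /= mulmxBl.
  rewrite [in RHS](_ : forall A B : 'M[R]_1, (A - B) 0 0 = A 0 0 - B 0 0).
    exact: shuffle.
  by move=> A B; rewrite !mxE.
have dm : differentiable (log_ratio c ct theta xi) (x xi).
  rewrite /log_ratio; apply: differentiableB => //.
  by apply: differentiableB; exact: differentiable_dotr.
have dctx j : differentiable (fun z => ct (x z) j 0) xi.
  exact: (differentiable_comp dx (dct j)).
have d1 := is_diff_comp (differentiableP dx) (differentiableP dm).
have d2 := is_diffB (differentiableP dpsi) (is_diff_cst (psi ct xi) xi).
apply: is_diff_eq (is_diffD d1 (is_diffB d2 (is_diff_dot_vanishing dctx))) _.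
apply/funext => v; rewrite !fctE /= !diff_grad// subr0.
have entryE (A B C : 'M[R]_1) : (A + (B - C)) 0 0 = A 0 0 + (B 0 0 - C 0 0).
  by rewrite !mxE.
by rewrite mulmxDr mulmxBr mulmxA -deriveEjacobian// deriveE// entryE.
Qed.

Lemma quad_massE (R : realType) d m n (c : 'rV[R]_d -> 'cV[R]_m)
    (ct : 'rV[R]_d -> 'cV[R]_n) (phi : 'rV[R]_n -> 'rV[R]_d -> 'rV[R]_d)
    (Q : quadrature R d) (theta : 'rV[R]_m) (z : 'rV[R]_n) :
  quad_mass c ct phi Q theta z =
  \sum_(i < qsize Q) qweight Q i
    * density_ratio c ct theta z (phi z (qnode Q i))
    * (qomega Q (qnode Q i))^-1.
Proof.
rewrite /quad_mass /quad_expect /node_expect.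
by under eq_bigr do rewrite [_ *: _]mulr1.
Qed.

(** Each node contributes its own value times the differential of the log ratio;
    the three parts of that differential sum to the three expectations. *)
Lemma is_diff_quad_mass (R : realType) d m n (c : 'rV[R]_d -> 'cV[R]_m)
    (ct : 'rV[R]_d -> 'cV[R]_n) (phi : 'rV[R]_n -> 'rV[R]_d -> 'rV[R]_d)
    (Q : quadrature R d) (theta : 'rV[R]_m) (xi : 'rV[R]_n) :
  (forall i j, differentiable (fun y => c y j 0) (phi xi (qnode Q i))) ->
  (forall i j, differentiable (fun y => ct y j 0) (phi xi (qnode Q i))) ->
  (forall i, differentiable (fun z => phi z (qnode Q i)) xi) ->
  differentiable (psi ct) xi ->
  is_diff xi (quad_mass c ct phi Q theta)
    (fun v => (v *m (chain_expect c ct phi Q theta xi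
      + (quad_mass c ct phi Q theta xi *: grad (psi ct) xi
         - stat_expect c ct phi Q theta xi))) 0 0).
Proof.
move=> dc dct dphi dpsi.
pose k i := qweight Q i * (qomega Q (qnode Q i))^-1 * (2 ^+ d)^-1.
set dmass := (X in is_diff _ _ X).
have -> : quad_mass c ct phi Q theta = fun z => \sum_(i < qsize Q)
    k i * expR (log_ratio c ct theta z (phi z (qnode Q i))).
  apply/funext => z; rewrite quad_massE; apply: eq_bigr => i _.
  by rewrite density_ratioE /k; ring.
have dterm i := is_diffZ (k i) (is_diff_expR_comp
  (is_diff_log_ratio theta (dc i) (dct i) (dphi i) dpsi)).
apply: is_diff_eq (is_diff_sum dterm) _.
apply/funext => v.
rewrite /dmass /chain_expect /stat_expect /quad_expect /node_expect.
rewrite quad_massE scaler_suml -sumrB -big_split/= mulmx_sumr summxE.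
apply: eq_bigr => i _; rewrite !fctE density_ratioE -/(k i).
rewrite -scalerBr -scalerDr -scalemxAr [RHS]mxE.
by rewrite -[LHS]/(k i * (_ * _)) mulrA; congr (_ * _); rewrite /k; ring.
Qed.

Lemma is_diff_sq_error (R : realType) d m n (c : 'rV[R]_d -> 'cV[R]_m)
    (ct : 'rV[R]_d -> 'cV[R]_n) (phi : 'rV[R]_n -> 'rV[R]_d -> 'rV[R]_d)
    (Q : quadrature R d) (theta : 'rV[R]_m) (xi : 'rV[R]_n)
    (dmass : 'rV[R]_n -> R) :
  is_diff xi (quad_mass c ct phi Q theta) dmass ->
  is_diff xi (sq_error c ct phi Q theta)
    (fun v => - (2 * quad_error c ct phi Q theta xi (fun=> 1)) * dmass v).
Proof.
move=> dm.
have dB := is_diffB (is_diff_cst (expect c theta (fun=> 1)) xi) dm.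
apply: is_diff_eq (is_diffX 1 dB) _.
apply/funext => v; rewrite !fctE sub0r expr1.
by rewrite -[LHS]/(_ * _) mulrN mulNr.
Qed.

Theorem proposition4 (R : realType) (d m n : nat)
    (c : 'rV[R]_d -> 'cV[R]_m) (ct : 'rV[R]_d -> 'cV[R]_n)
    (phi : 'rV[R]_n -> 'rV[R]_d -> 'rV[R]_d) (Q : quadrature R d)
    (theta : 'rV[R]_m) (xi : 'rV[R]_n)
    (hc : regular_family c) (hct : regular_family ct)
    (hct2 : forall j, C2_fun (fun x => ct x j 0))
    (htheta : Theta c theta) (hxi : Theta ct xi)
    (hphi : forall z, Theta ct z -> density_bijection (em_density ct z) (phi z))
    (hphi_xi : forall i, differentiable (fun z => phi z (qnode Q i)) xi)
    (hc_diff : forall i j,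
       differentiable (fun x => c x j 0) (phi xi (qnode Q i))) :
  [/\ quad_mass c ct phi Q theta xi != 0 ->
      grad (psi ct) xi
        - (quad_mass c ct phi Q theta xi)^-1 *: stat_expect c ct phi Q theta xi
        + (quad_mass c ct phi Q theta xi)^-1 *: chain_expect c ct phi Q theta xi
        = 0 ->
      first_order_optimum (sq_error c ct phi Q theta) xi,
      quad_mass c ct phi Q theta xi != 0 ->
      moment_matching c ct phi Q theta xi ->
      chain_expect c ct phi Q theta xi = 0 ->
      first_order_optimum (sq_error c ct phi Q theta) xi &
      forall e : m = n,
      (forall x, ct x = castmx (e, erefl 1%N) (c x)) ->
      xi = castmx (erefl 1%N, e) theta ->
      (quad_mass c ct phi Q theta xi != 0 ->
       moment_matching c ct phi Q theta xi ->
       first_order_optimum (sq_error c ct phi Q theta) xi) /\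
      (exact_on_inv_omega Q ->
       first_order_optimum (sq_error c ct phi Q theta) xi /\
       local_minimum (sq_error c ct phi Q theta) xi)].
Proof.
have dmass := is_diff_quad_mass theta hc_diff
    (fun i j => (hct2 j).1.1 (phi xi (qnode Q i))) hphi_xi
    (differentiable_psi hct hxi).
have [derr derrE] := is_diff_sq_error dmass.
have partA : quad_mass c ct phi Q theta xi != 0 ->
      grad (psi ct) xi
        - (quad_mass c ct phi Q theta xi)^-1 *: stat_expect c ct phi Q theta xi
        + (quad_mass c ct phi Q theta xi)^-1 *: chain_expect c ct phi Q theta xi
        = 0 ->
      first_order_optimum (sq_error c ct phi Q theta) xi.
  move=> mass0 crit; split=> // v; rewrite derrE.
  (* G is the quadrature mass times the left-hand side of the criterion. *)
  set G := (G in v *m G); suff -> : G = 0 by rewrite mulmx0 mxE mulr0.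
  rewrite -[RHS](scaler0 _ (quad_mass c ct phi Q theta xi)) -crit.
  by rewrite scalerDr scalerBr !scalerA mulfV// !scale1r addrC.
have partB : quad_mass c ct phi Q theta xi != 0 ->
      moment_matching c ct phi Q theta xi ->
      chain_expect c ct phi Q theta xi = 0 ->
      first_order_optimum (sq_error c ct phi Q theta) xi.
  move=> mass0 mm chain0; apply: partA => //.
  by rewrite chain0 scaler0 addr0 mm subrr.
split=> // e ctE xiE.
(* The densities p_theta and q_xi coincide. *)
have lr0 : log_ratio c ct theta xi = cst 0.
  apply/funext => x; move: ctE xiE; clear.
  case: _ / e ct xi => ct xi ctE ->.
  rewrite castmx_id (_ : ct = c); last first.
    by apply/funext => y; rewrite ctE castmx_id.
  by rewrite /log_ratio !subrr.
split=> [mass0 mm|exactQ].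
  apply: partB => //; rewrite /chain_expect /node_expect big1// => i _.
  rewrite lr0 (_ : grad _ _ = 0) ?mulmx0 ?scaler0//.
  by apply/matrixP => k l; rewrite !mxE derive_cst.
have mass1 : quad_mass c ct phi Q theta xi = 1.
  rewrite quad_massE; under eq_bigr do
    rewrite density_ratioE lr0 expR0 mulr1 mulrAC.
  by rewrite -mulr_suml exactQ mulfV// expf_neq0// pnatr_eq0.
have err0 : quad_error c ct phi Q theta xi (fun=> 1) = 0.
  rewrite /quad_error expect_one//; last by case: hc.
  rewrite -[quad_expect _ _ _ _ _ _ _]/(quad_mass c ct phi Q theta xi).
  by rewrite mass1 subrr.
split.
  by split=> // v; rewrite derrE err0 mulr0 oppr0 mul0r.
rewrite /local_minimum; near=> y; rewrite /sq_error err0 expr0n/= sqr_ge0.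
Unshelve. all: by end_near. Qed.
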